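(* Let $\mathcal{A}\in S_{m,n}$ be strictly semi-positive and let $\mathbf{q}\in\mathbb{R}^n$. If $\mathbf{x}$ is a solution of the tensor complementarity problem TCP$(\mathcal{A},\mathbf{q})$, then $$\|\mathbf{x}\|_m^{m-1}\le\frac{\|(-\mathbf{q})_+\|_{\frac{m}{m-1}}}{\lambda(\mathcal{A})}.$$
   Context: A real $m$th order $n$-dimensional tensor is an array $\mathcal{A}=(a_{i_1\cdots i_m})$ of real numbers, $1\le i_1,\dots,i_m\le n$, with order $m\ge 2$; $S_{m,n}$ is the set of those that are symmetric, i.e. whose entries are invariant under any permutation of the indices. For $\mathbf{x}\in\mathbb{R}^n$, $\mathcal{A}\mathbf{x}^{m-1}\in\mathbb{R}^n$ is the vector with components $(\mathcal{A}\mathbf{x}^{m-1})_i=\sum_{i_2,\dots,i_m=1}^n a_{ii_2\cdots i_m}x_{i_2}\cdots x_{i_m}$, and $\mathcal{A}\mathbf{x}^m=\mathbf{x}^\top(\mathcal{A}\mathbf{x}^{m-1})$. For vectors, $\mathbf{x}\ge\mathbf{0}$ means $x_i\ge 0$ for all $i$. $\mathcal{A}$ is strictly semi-positive iff for each $\mathbf{x}\ge\mathbf{0}$ with $\mathbf{x}\ne\mathbf{0}$ there is an index $k\in\{1,\dots,n\}$ with $x_k>0$ and $(\mathcal{A}\mathbf{x}^{m-1})_k>0$. A solution of TCP$(\mathcal{A},\mathbf{q})$ is a vector $\mathbf{x}\in\mathbb{R}^n$ with $\mathbf{x}\ge\mathbf{0}$, $\mathbf{q}+\mathcal{A}\mathbf{x}^{m-1}\ge\mathbf{0}$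 and $\mathbf{x}^\top(\mathbf{q}+\mathcal{A}\mathbf{x}^{m-1})=0$. For real $p\ge1$, $\|\mathbf{x}\|_p=(\sum_{i=1}^n|x_i|^p)^{1/p}$; $\mathbf{x}_+=(\max\{x_1,0\},\dots,\max\{x_n,0\})^\top$; and $$\lambda(\mathcal{A}):=\min\{\mathcal{A}\mathbf{y}^m:\ \mathbf{y}\ge\mathbf{0},\ \|\mathbf{y}\|_m=1\}.$$ *)

(* Defs.v *)
From HB Require Import structures.
From mathcomp Require Import all_boot all_order all_fingroup all_algebra.
From mathcomp Require Import all_classical all_reals all_analysis.

Set Implicit Arguments.
Unset Strict Implicit.
Unset Printing Implicit Defensive.

Import Order.TTheory GRing.Theory Num.Theory.

Local Open Scope classical_set_scope.
Local Open Scope ring_scope.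

Definition tensor (R : realType) (m n : nat) : Type :=
  {ffun m.-tuple 'I_n -> R}.

Definition tensor_sym (R : realType) (m n : nat) (A : tensor R m n) : Prop :=
  forall (s : 'S_m) (t : m.-tuple 'I_n), A [tuple tnth t (s i) | i < m] = A t.

(* Component i of A x^(m-1): the sum runs over the index tuples
   (i_1, ..., i_m) whose first entry is i, and the product over i_2, ..., i_m. *)
Definition tensor_app (R : realType) (m n : nat) (A : tensor R m n)
    (x : 'cV[R]_n) : 'cV[R]_n :=
  \col_(i < n) \sum_(t : m.-tuple 'I_n | ohead t == Some i)
    A t * \prod_(j <- behead t) x j 0.

Definition tensor_form (R : realType) (m n : nat) (A : tensor R m n)
    (x : 'cV[R]_n) : R :=
  (x^T *m tensor_app A x) 0 0.

Definition nonneg_vec (R : realType) (n : nat) (x : 'cV[R]_n) : Prop :=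
  forall i : 'I_n, 0 <= x i 0.

Definition strictly_semi_positive (R : realType) (m n : nat)
    (A : tensor R m n) : Prop :=
  forall x : 'cV[R]_n, nonneg_vec x -> x <> 0 ->
    exists k : 'I_n, 0 < x k 0 /\ 0 < tensor_app A x k 0.

Definition tcp_solution (R : realType) (m n : nat) (A : tensor R m n)
    (q x : 'cV[R]_n) : Prop :=
  [/\ nonneg_vec x,
      nonneg_vec (q + tensor_app A x) &
      x^T *m (q + tensor_app A x) = 0].

Definition pnorm (R : realType) (n : nat) (p : R) (x : 'cV[R]_n) : R :=
  (\sum_(i < n) `|x i 0| `^ p) `^ p^-1.

Definition pos_part (R : realType) (n : nat) (x : 'cV[R]_n) : 'cV[R]_n :=
  \col_(i < n) Num.max (x i 0) 0.

(* The least element of S (0 if S has no least element). *)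
Definition set_min (R : realType) (S : set R) : R :=
  xget 0 (S `&` lbound S).

Definition tensor_lambda (R : realType) (m n : nat) (A : tensor R m n) : R :=
  set_min [set tensor_form A y | y in
             [set y : 'cV[R]_n | nonneg_vec y /\ pnorm m%:R y = 1]].

(* Main.v *)
Require Import Defs.
From HB Require Import structures.
From mathcomp Require Import all_boot all_order all_fingroup all_algebra.
From mathcomp Require Import all_classical all_reals all_analysis.

(** For a solution [x], complementarity gives [A x^m = - q . x], hence
    [A x^m <= (-q)_+ . x] because [x >= 0] ([tcp_form_le]).  Hoelder's
    inequality with the conjugate exponents [m] and [m / (m - 1)]
    ([hoelder_pnorm]) bounds the right-hand side by [||(-q)_+|| ||x||_m],
    while homogeneity of degree [m] gives
    [lambda(A) ||x||_m^m <= A x^m] ([tensor_lambda_le_form]).  The theorem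
    follows on dividing by [lambda(A) ||x||_m].

    If [x = 0], it suffices that [lambda(A) >= 0].  For [x <> 0] the division
    needs [lambda(A) > 0] ([tensor_lambda_gt0]), and this is where symmetry
    is used.  By compactness the minimum defining [lambda(A)]
    is attained at some [y] ([tensor_lambda_min]).  Strict semi-positivity at
    [y] gives an index [k] with [y_k > 0] and [(A y^(m-1))_k > 0].  For
    symmetric [A] the gradient of [A y^m] is [m A y^(m-1)]
    ([line_poly_slope]), so replacing [y_k] by the slightly smaller [y_k - s]
    strictly decreases the form; it keeps the vector nonnegative and does not
    increase its norm.  If [lambda(A)] were [<= 0], the new vector [z] would
    satisfy [A z^m < lambda(A) <= lambda(A) ||z||_m^m], against
    homogeneity. *)

Import Order.TTheory GRing.Theory Num.Theory.
Import numFieldNormedType.Exports.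
Local Open Scope classical_set_scope.
Local Open Scope ring_scope.

(** * The homogeneous form of a tensor *)

Lemma tensor_appE (R : realType) (m n : nat) (A : tensor R m.+1 n)
    (x : 'cV[R]_n) (i : 'I_n) :
  tensor_app A x i 0 =
  \sum_(t : m.+1.-tuple 'I_n | tnth t ord0 == i)
     A t * \prod_(l | l != ord0) x (tnth t l) 0.
Proof.
rewrite mxE; apply: eq_big => [t|t _].
  by case/tupleP: t => h t.
case/tupleP: t => h t /=; congr (_ * _).
rewrite big_tuple [RHS]big_mkcond big_ord_recl /= mul1r.
by apply: eq_bigr => l _; rewrite tnthS.
Qed.

(** Grouping all index tuples by their first entry merges the outer product
    with [d] and the inner sums of [tensor_app] into one sum.  With [d := x]
    this is the form itself; with general [d] it is its directional derivative
    up to the factor [m]. *)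
Lemma dot_tensor_appE (R : realType) (m n : nat) (A : tensor R m.+1 n)
    (d x : 'cV[R]_n) :
  (d^T *m tensor_app A x) 0 0 =
  \sum_t A t * (d (tnth t ord0) 0 * \prod_(l | l != ord0) x (tnth t l) 0).
Proof.
rewrite mxE [RHS](partition_big (fun t => tnth t ord0) predT) //=.
apply: eq_bigr => i _; rewrite tensor_appE mxE mulr_sumr.
by apply: eq_bigr => t /eqP ->; rewrite mulrCA.
Qed.

Lemma tensor_formE (R : realType) (m n : nat) (A : tensor R m.+1 n)
    (x : 'cV[R]_n) :
  tensor_form A x = \sum_t A t * \prod_l x (tnth t l) 0.
Proof.
by rewrite /tensor_form dot_tensor_appE; apply: eq_bigr => t _;
   rewrite [in RHS](bigD1 ord0).
Qed.

Lemma tensor_formZ (R : realType) (m n : nat) (A : tensor R m.+1 n) c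
    (x : 'cV[R]_n) :
  tensor_form A (c *: x) = c ^+ m.+1 * tensor_form A x.
Proof.
rewrite !tensor_formE mulr_sumr; apply: eq_bigr => t _.
rewrite mulrCA; congr (_ * _).
under eq_bigr do rewrite mxE.
by rewrite big_split prodr_const card_ord.
Qed.

Lemma tensor_form0 (R : realType) (m n : nat) (A : tensor R m n) :
  tensor_form A 0 = 0.
Proof. by rewrite /tensor_form trmx0 mul0mx mxE. Qed.

(** * Directional derivatives of the form *)

(** Uniqueness of [r] is what makes the filter [i != j] remove exactly one
    factor. *)
Lemma deriv_prod_seq (R : comNzRingType) (I : eqType) (r : seq I)
    (f : I -> {poly R}) :
  uniq r ->
  (\prod_(i <- r) f i)^`() =
  \sum_(j <- r) (f j)^`() * \prod_(i <- r | i != j) f i.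
Proof.
elim: r => [|a r IHr] /=; first by rewrite !big_nil derivC.
case/andP=> ar ur; rewrite !big_cons derivM IHr // eqxx /=.
congr (_ * _ + _).
  rewrite [RHS]big_seq_cond [LHS]big_seq; apply: eq_bigl => i.
  by case: (boolP (i \in r)) => //= ir; apply/esym; apply: contraNneq ar => <-.
rewrite mulr_sumr [LHS]big_seq [RHS]big_seq; apply: eq_bigr => j jr.
rewrite big_cons (_ : a != j); first by rewrite mulrCA.
by apply: contraNneq ar => ->.
Qed.

Lemma deriv_prod (R : comNzRingType) (I : finType) (f : I -> {poly R}) :
  (\prod_i f i)^`() = \sum_j (f j)^`() * \prod_(i | i != j) f i.
Proof. exact/deriv_prod_seq/index_enum_uniq. Qed.

(** The form restricted to the line [s |-> x + s d], as a formal polynomial in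
    [s], so that its derivative can be computed algebraically. *)
Definition line_poly {R : realType} {m n : nat} (A : tensor R m n)
    (x d : 'cV[R]_n) : {poly R} :=
  \sum_t (A t)%:P *
    \prod_l ((x (tnth t l) 0)%:P + (d (tnth t l) 0)%:P * 'X).

Lemma horner_line_poly (R : realType) (m n : nat) (A : tensor R m.+1 n)
    (x d : 'cV[R]_n) (s : R) :
  (line_poly A x d).[s] = tensor_form A (x + s *: d).
Proof.
rewrite tensor_formE horner_sum; apply: eq_bigr => t _.
rewrite !hornerE horner_prod; congr (_ * _); apply: eq_bigr => l _.
by rewrite !hornerE !mxE mulrC.
Qed.

(** The gradient of [A x^m] is [m A x^(m-1)].  The product rule yields one term
    for each of the [m] index positions; exchanging position [j] with the first
    one leaves the entries of a symmetric tensor unchanged, so all these terms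
    are equal. *)
Lemma line_poly_slope (R : realType) (m n : nat) (A : tensor R m.+1 n)
    (x d : 'cV[R]_n) :
  tensor_sym A ->
  (line_poly A x d)^`().[0] = (d^T *m tensor_app A x) 0 0 *+ m.+1.
Proof.
move=> symA; rewrite dot_tensor_appE linear_sum /= horner_sum.
under [LHS]eq_bigr => t _.
  rewrite derivM derivC mul0r add0r deriv_prod !hornerE horner_sum mulr_sumr.
  under eq_bigr => j _.
    rewrite derivD derivM !derivC derivX mul0r !add0r mulr1 !hornerE horner_prod.
    under eq_bigr do rewrite !hornerE.
    over.
  over.
rewrite exchange_big /=; set V := \sum_t A t * (_ * _).
rewrite -[X in V *+ X](card_ord m.+1) -sumr_const {}/V.
apply: eq_bigr => j _.
pose swap (t : m.+1.-tuple 'I_n) := [tuple tnth t (tperm ord0 j l) | l < m.+1].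
have swapK : involutive swap.
  by move=> t; apply: eq_from_tnth => l; rewrite !tnth_mktuple tpermK.
(* Two reindexings: the tuples by exchanging entries 0 and j, then the factors
   by the same transposition of positions. *)
rewrite (reindex_inj (inv_inj swapK)); apply: eq_bigr => t _.
rewrite symA tnth_mktuple tpermR -mulrA; congr (_ * (_ * _)).
rewrite (reindex_inj (@perm_inj _ (tperm ord0 j))); apply: eq_big => l.
  by rewrite -{2}(tpermL ord0 j) (inj_eq perm_inj).
by rewrite tnth_mktuple tpermK.
Qed.

(** Writing [p = q 'X + c], the slope at 0 is [q.[0]]; by continuity [q] stays
    negative just to the right of 0. *)
Lemma horner_decr_right (R : realType) (p : {poly R}) (e : R) :
  p^`().[0] < 0 -> 0 < e -> exists s, [/\ 0 < s, s <= e & p.[s] < p.[0]].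
Proof.
elim/poly_ind: p => [|q c _]; first by rewrite derivC horner0 ltxx.
rewrite derivMXaddC !hornerE => q0 e0.
have nq : \forall s \near (0 : R)^'+, q.[s] < 0.
  apply: cvgr_lt q0; apply: cvg_at_right_filter; exact: continuous_horner.
have : \forall s \near (0 : R)^'+, [/\ 0 < s, s <= e & q.[s] < 0].
  near=> s; split; near: s => //; [exact: nbhs_right_gt|exact: nbhs_right_le].
move=> /filter_ex [s [s0 se qs]]; exists s; split => //.
by rewrite !hornerE gtrDr pmulr_llt0.
Unshelve. all: by end_near.
Qed.

(** * The p-norm and Hoelder's inequality *)

Lemma pnorm_ge0 (R : realType) (n : nat) (p : R) (x : 'cV[R]_n) :
  0 <= pnorm p x.
Proof. exact: powR_ge0. Qed.

Lemma pnorm_powR (R : realType) (n : nat) (p : R) (x : 'cV[R]_n) :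
  p != 0 -> pnorm p x `^ p = \sum_i `|x i 0| `^ p.
Proof.
move=> p0; rewrite -powRrM mulVf // powRr1 //.
by apply: sumr_ge0 => i _; exact: powR_ge0.
Qed.

Lemma pnorm_exp (R : realType) (m n : nat) (x : 'cV[R]_n) :
  pnorm m.+1%:R x ^+ m.+1 = \sum_i `|x i 0| ^+ m.+1.
Proof.
rewrite -powR_mulrn ?pnorm_ge0 // pnorm_powR ?pnatr_eq0 //.
by apply: eq_bigr => i _; rewrite powR_mulrn.
Qed.

Lemma pnorm_eq0 (R : realType) (n : nat) (p : R) (x : 'cV[R]_n) :
  p != 0 -> (pnorm p x == 0) = (x == 0).
Proof.
move=> p0; rewrite powR_eq0 invr_eq0 p0 andbT psumr_eq0; last first.
  by move=> i _; exact: powR_ge0.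
apply/allP/eqP => [x0|-> i _]; last by rewrite mxE normr0 powR0 /= ?eqxx.
apply/colP => i; rewrite mxE; have := x0 i (mem_index_enum _).
by rewrite powR_eq0 p0 andbT normr_eq0 => /eqP.
Qed.

(** After dividing both vectors by their norms, Young's inequality
    [a b <= a^p / p + b^q / q] is summed coordinatewise: the right-hand side
    becomes [1 / p + 1 / q = 1].  Vectors of norm zero vanish and are treated
    apart. *)
Lemma hoelder_pnorm (R : realType) (n : nat) (p q : R) (x y : 'cV[R]_n) :
  0 < p -> 0 < q -> p^-1 + q^-1 = 1 ->
  \sum_i `|x i 0| * `|y i 0| <= pnorm p x * pnorm q y.
Proof.
move=> p0 q0 pq.
have [/eqP|x0] := eqVneq (pnorm p x) 0.
  rewrite pnorm_eq0 ?gt_eqF // => /eqP ->.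
  by rewrite big1 ?mulr_ge0 ?pnorm_ge0 // => i _; rewrite mxE normr0 mul0r.
have [/eqP|y0] := eqVneq (pnorm q y) 0.
  rewrite pnorm_eq0 ?gt_eqF // => /eqP ->.
  by rewrite big1 ?mulr_ge0 ?pnorm_ge0 // => i _; rewrite mxE normr0 mulr0.
have {}x0 : 0 < pnorm p x by rewrite lt_neqAle eq_sym x0 pnorm_ge0.
have {}y0 : 0 < pnorm q y by rewrite lt_neqAle eq_sym y0 pnorm_ge0.
have normalized_sum r (z : 'cV[R]_n) : 0 < r -> 0 < pnorm r z ->
    \sum_i (`|z i 0| / pnorm r z) `^ r = 1.
  move=> r0 z0; under eq_bigr do rewrite powRM ?invr_ge0 ?pnorm_ge0 //.
  rewrite -mulr_suml -pnorm_powR ?gt_eqF // -powRM ?invr_ge0 ?pnorm_ge0 //.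
  by rewrite mulfV ?powR1 ?gt_eqF.
have NM0 := mulr_gt0 x0 y0.
suff: (\sum_i `|x i 0| * `|y i 0|) / (pnorm p x * pnorm q y) <= 1.
  by rewrite ler_pdivrMr // mul1r.
rewrite mulr_suml.
have -> : 1 = \sum_i ((`|x i 0| / pnorm p x) `^ p / p +
                      (`|y i 0| / pnorm q y) `^ q / q).
  rewrite big_split /= -mulr_suml (normalized_sum _ _ p0 x0).
  by rewrite -mulr_suml (normalized_sum _ _ q0 y0) !div1r.
apply: ler_sum => i _; rewrite invfM mulrACA.
by rewrite conjugate_powR // divr_ge0 ?pnorm_ge0.
Qed.

(** * Attainment and sign of the minimum *)

Definition nonneg_unit_sphere {R : realType} (m : nat) {n : nat} :
    set 'cV[R]_n :=
  [set y | nonneg_vec y /\ pnorm m%:R y = 1]%classic.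

(** Replaces the real powers in the norm constraint by a polynomial equation,
    whose solution set is visibly closed. *)
Lemma pnorm_eq1 (R : realType) (m n : nat) (y : 'cV[R]_n) :
  nonneg_vec y ->
  pnorm m.+1%:R y = 1 <-> \sum_i y i 0 ^+ m.+1 = 1.
Proof.
move=> y0; rewrite -(eq_bigr _ (fun i _ => congr1 (fun z => z ^+ m.+1)
  (ger0_norm (y0 i)))) -pnorm_exp; split=> [->|/eqP]; first by rewrite expr1n.
by rewrite pexpr_eq1 ?pnorm_ge0 // => /eqP.
Qed.

Lemma continuous_sum (R : realType) (T : topologicalType) (I : Type)
    (r : seq I) (f : I -> T -> R) :
  (forall i, continuous (f i)) -> continuous (fun x => \sum_(i <- r) f i x).
Proof.
move=> cf; elim: r => [|i r IHr].
  rewrite (_ : (fun x => _) = fun=> 0); first exact: cst_continuous.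
  by apply/funext => x; rewrite big_nil.
rewrite (_ : (fun x => _) = fun x => f i x + \sum_(j <- r) f j x).
  by move=> x; apply: cvgD; [exact: cf|exact: IHr].
by apply/funext => x; rewrite big_cons.
Qed.

Lemma continuous_prod (R : realType) (T : topologicalType) (I : Type)
    (r : seq I) (f : I -> T -> R) :
  (forall i, continuous (f i)) -> continuous (fun x => \prod_(i <- r) f i x).
Proof.
move=> cf; elim: r => [|i r IHr].
  rewrite (_ : (fun x => _) = fun=> 1); first exact: cst_continuous.
  by apply/funext => x; rewrite big_nil.
rewrite (_ : (fun x => _) = fun x => f i x * \prod_(j <- r) f j x).
  by move=> x; apply: cvgM; [exact: cf|exact: IHr].
by apply/funext => x; rewrite big_cons.
Qed.

(** The domain consists of row vectors because the compact boxes used below are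
    sets of row vectors. *)
Lemma continuous_tensor_form_tr (R : realType) (m n : nat)
    (A : tensor R m.+1 n) :
  continuous (fun v : 'rV[R]_n => tensor_form A v^T).
Proof.
have -> : (fun v : 'rV[R]_n => tensor_form A v^T) =
    fun v => \sum_t A t * \prod_l v 0 (tnth t l).
  apply/funext => v; rewrite tensor_formE; apply: eq_bigr => t _.
  by under eq_bigr do rewrite mxE.
have cprod (t : m.+1.-tuple 'I_n) :
    continuous (fun v : 'rV[R]_n => \prod_l v 0 (tnth t l)).
  by apply: continuous_prod => l; exact: coord_continuous.
apply: continuous_sum => t v.
have ccst : continuous (fun _ : 'rV[R]_n => A t) by exact: cst_continuous.
exact: (continuousM (ccst v) (cprod t v)).
Qed.

(** A closed subset of the cube [[0, 1]^n]: each term of the sum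
    [\sum_i y_i^m = 1] of nonnegative terms is at most 1. *)
Lemma nonneg_unit_sphere_compact (R : realType) (m n : nat) :
  compact [set v : 'rV[R]_n | nonneg_unit_sphere m.+1 v^T]%classic.
Proof.
pose N (v : 'rV[R]_n) := \sum_i v 0 i ^+ m.+1.
have cN : continuous N.
  apply: continuous_sum => i v.
  apply: (@continuous_comp _ _ _ (fun u : 'rV[R]_n => u 0 i)
    (fun a : R => a ^+ m.+1)); first exact: coord_continuous.
  exact: exprn_continuous.
rewrite (_ : mkset _ =
    ([set v : 'rV[R]_n | forall i, (`[0, 1]%classic : set R) (v ord0 i)] `&`
     N @^-1` [set 1])%classic).
  apply: compact_closedI.
    exact: (@rV_compact R n (fun=> `[0, 1]%classic)
                        (fun=> @segment_compact R 0 1)).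
  by apply: (preimage_closed (fun v _ => cN v)); exact: closed_eq.
have Ntr v : \sum_i v^T i 0 ^+ m.+1 = N v by apply: eq_bigr => i _; rewrite mxE.
apply/seteqP; split=> v /= [v0 v1].
  have {}v1 : N v = 1 by rewrite -Ntr; apply/pnorm_eq1.
  have {}v0 i : 0 <= v 0 i by have := v0 i; rewrite mxE.
  split=> // i; rewrite in_itv /= v0 /= -(@expr_le1 _ m.+1) // -v1.
  by rewrite /N (bigD1 i) //= lerDl; apply: sumr_ge0 => j _; exact: exprn_ge0.
have nonneg_v : nonneg_vec v^T.
  by move=> i; rewrite mxE; have := v0 i; rewrite in_itv /= => /andP[].
by split=> //; apply/pnorm_eq1 => //; rewrite Ntr.
Qed.

(** The extreme value theorem shows that the set of values of the form has a
    least element, so that [tensor_lambda] does not take the default value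
    of [set_min]. *)
Lemma tensor_lambda_min (R : realType) (m n : nat) (A : tensor R m.+1 n) :
  (exists z : 'cV[R]_n, nonneg_unit_sphere m.+1 z) ->
  (exists2 y, nonneg_unit_sphere m.+1 y & tensor_form A y = tensor_lambda A) /\
  forall z, nonneg_unit_sphere m.+1 z -> tensor_lambda A <= tensor_form A z.
Proof.
move=> [x xS].
have [||v vS vmin] := @compact_EVT_min _ _ (fun v => tensor_form A v^T) _
    _ (nonneg_unit_sphere_compact R m n).
- by exists x^T; rewrite /= trmxK.
- exact/continuous_subspaceT/continuous_tensor_form_tr.
rewrite /tensor_lambda /set_min; set S := (X in xget 0 (X `&` _)).
have /(xgetPex 0) : exists a, (S `&` lbound S)%classic a.
  exists (tensor_form A v^T); split; first by exists v^T => //; exact: set_mem.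
  move=> _ [z zS <-].
  by have := vmin z^T; rewrite inE /= trmxK; apply.
by move=> [[y yS <-] lb]; split=> [|z zS]; [exists y|apply: lb; exists z].
Qed.

Lemma pnorm_normalize (R : realType) (m n : nat) (x : 'cV[R]_n) :
  nonneg_vec x -> x != 0 -> nonneg_unit_sphere m.+1 ((pnorm m.+1%:R x)^-1 *: x).
Proof.
move=> x0 xn0.
have N0 : 0 < pnorm m.+1%:R x.
  by rewrite lt_neqAle eq_sym pnorm_eq0 ?pnatr_eq0 // xn0 pnorm_ge0.
have y0 : nonneg_vec ((pnorm m.+1%:R x)^-1 *: x).
  by move=> i; rewrite mxE mulr_ge0 // invr_ge0 pnorm_ge0.
split=> //; apply/(pnorm_eq1 _ _ _ _ y0).
under eq_bigr do rewrite mxE exprMn -[in X in _ * X](ger0_norm (x0 _)).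
by rewrite -mulr_sumr -pnorm_exp -exprMn mulVf ?expr1n ?gt_eqF.
Qed.

(** Homogeneity extends the bound from the unit sphere to the whole orthant. *)
Lemma tensor_lambda_le_form (R : realType) (m n : nat) (A : tensor R m.+1 n)
    (x : 'cV[R]_n) :
  nonneg_vec x ->
  tensor_lambda A * pnorm m.+1%:R x ^+ m.+1 <= tensor_form A x.
Proof.
have [-> _|xn0 x0] := eqVneq x 0.
  rewrite tensor_form0 (_ : pnorm _ _ = 0) ?expr0n ?mulr0 //.
  by apply/eqP; rewrite pnorm_eq0 ?pnatr_eq0.
have xS := pnorm_normalize _ m _ _ x0 xn0.
have [_ /(_ _ xS)] := tensor_lambda_min _ _ _ A (ex_intro _ _ xS).
rewrite tensor_formZ exprVn mulrC ler_pdivlMr // exprn_gt0 //.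
by rewrite lt_neqAle eq_sym pnorm_eq0 ?pnatr_eq0 // xn0 pnorm_ge0.
Qed.

(** At a minimizer [y] with nonpositive value, the form could still be decreased
    by lowering a coordinate [k] provided by strict semi-positivity, with
    nonnegativity and [||.||_m <= 1] preserved.  The vector [x] only witnesses
    that the orthant is not reduced to 0, that is, [n > 0]. *)
Lemma tensor_lambda_gt0 (R : realType) (m n : nat) (A : tensor R m.+1 n)
    (x : 'cV[R]_n) :
  tensor_sym A -> strictly_semi_positive A -> nonneg_vec x -> x != 0 ->
  0 < tensor_lambda A.
Proof.
move=> symA sspA x0 xn0; rewrite ltNge; apply/negP => lam_le0.
have xS := pnorm_normalize _ m _ _ x0 xn0.
have [[y [y0 y1] ylam] _] := tensor_lambda_min _ _ _ A (ex_intro _ _ xS).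
have yn0 : y <> 0.
  by move/eqP; rewrite -(@pnorm_eq0 _ _ m.+1%:R) ?pnatr_eq0 // y1 oner_eq0.
have [k [yk Ayk]] := sspA y y0 yn0.
pose d : 'cV[R]_n := - delta_mx k 0.
have slope : (line_poly A y d)^`().[0] < 0.
  rewrite line_poly_slope // pmulrn_llt0 // linearN /= mulNmx mxE oppr_lt0.
  by rewrite trmx_delta -rowE mxE.
have [s [s0 sy]] := horner_decr_right _ _ _ slope yk.
rewrite !horner_line_poly scale0r addr0 ylam; set z := y + s *: d => zlt.
have zE i : z i 0 = y i 0 - s *+ (i == k).
  by rewrite !mxE eqxx andbT mulrN mulr_natr.
have z0 : nonneg_vec z.
  move=> i; rewrite zE; case: eqP => [->|_]; last by rewrite subr0.
  by rewrite subr_ge0.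
have zle : pnorm m.+1%:R z ^+ m.+1 <= 1.
  have sumY : \sum_i `|y i 0| ^+ m.+1 = 1 by rewrite -pnorm_exp y1 expr1n.
  rewrite pnorm_exp -[leRHS]sumY; apply: ler_sum => i _.
  rewrite !ger0_norm // lerXn2r // ?nnegrE // zE gerBl.
  by rewrite mulrn_wge0 // ltW.
have := tensor_lambda_le_form _ _ _ A z z0; apply/negP; rewrite -ltNge.
by apply: lt_le_trans zlt _; rewrite ler_niMr.
Qed.

(** Covers also dimension 0, where the constraint set is empty and
    [tensor_lambda] is the default value 0. *)
Lemma tensor_lambda_ge0 (R : realType) (m n : nat) (A : tensor R m.+1 n) :
  tensor_sym A -> strictly_semi_positive A -> 0 <= tensor_lambda A.
Proof.
move=> symA sspA; have [[x [x0 xn0]]|none] :=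
    pselect (exists x : 'cV[R]_n, nonneg_vec x /\ x != 0).
  exact/ltW/(tensor_lambda_gt0 _ _ _ A x).
rewrite /tensor_lambda /set_min; case: xgetP => // _ -> [[y [y0 y1] _] _].
exfalso; apply: none; exists y; split=> //.
by rewrite -(@pnorm_eq0 _ _ m.+1%:R) ?pnatr_eq0 // y1 oner_eq0.
Qed.

(** * The norm bound for solutions *)

(** Complementarity turns the form into [- q . x], and [x >= 0] allows [- q]
    to be replaced by its positive part. *)
Lemma tcp_form_le (R : realType) (m n : nat) (A : tensor R m n)
    (q x : 'cV[R]_n) :
  tcp_solution A q x ->
  tensor_form A x <= \sum_i `|x i 0| * `|pos_part (- q) i 0|.
Proof.
case=> x0 _ /(congr1 (fun M : 'M[R]_1 => M 0 0)).
rewrite mulmxDr !mxE => /eqP; rewrite addrC addr_eq0 => /eqP.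
rewrite /tensor_form mxE => ->; rewrite -sumrN; apply: ler_sum => i _.
rewrite !mxE (ger0_norm (x0 i)) -mulrN ler_wpM2l //.
by apply: le_trans (ler_norm _); rewrite le_max lexx.
Qed.

Theorem theorem3p6 (R : realType) (m n : nat) (hm : (2 <= m)%N)
    (A : tensor R m n) (q x : 'cV[R]_n) :
  tensor_sym A ->
  strictly_semi_positive A ->
  tcp_solution A q x ->
  pnorm m%:R x ^+ m.-1
    <= pnorm (m%:R / m.-1%:R) (pos_part (- q)) / tensor_lambda A.
Proof.
case: m hm A => [|[|m]] //= _ A symA sspA sol.
have x0 : nonneg_vec x by case: sol.
have [->|xn0] := eqVneq x 0.
  have -> : pnorm m.+2%:R (0 : 'cV[R]_n) = 0.
    by apply/eqP; rewrite pnorm_eq0 ?pnatr_eq0.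
  by rewrite expr0n divr_ge0 ?pnorm_ge0 ?tensor_lambda_ge0.
have N0 : 0 < pnorm m.+2%:R x.
  by rewrite lt_neqAle eq_sym pnorm_eq0 ?pnatr_eq0 // xn0 pnorm_ge0.
have lam0 := tensor_lambda_gt0 _ _ _ A x symA sspA x0 xn0.
rewrite (ler_pdivlMr _ _ lam0) -(ler_pM2r N0).
rewrite mulrAC -exprSr mulrC [leRHS]mulrC.
apply: le_trans (tensor_lambda_le_form _ _ _ A x x0) _.
apply: le_trans (tcp_form_le _ _ _ _ _ _ sol) _.
apply: hoelder_pnorm; rewrite ?divr_gt0 ?ltr0n //.
by rewrite invf_div -[X in X + _]mul1r -mulrDl nat1r mulfV ?pnatr_eq0.
Qed.
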